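(* Let $L_1:=L_1(1,\infty)$ and let $A$ be the bounded operator on $L_1$ given by $(Au)(s)=u(s)/s$. Let $g$ be a Stieltjes function with representation $(0,0,\mu)$ and $g(0+)=\infty$. Assume that for some $\alpha\in(0,1)$ the function $\tau\mapsto\tau^\alpha g(\tau)$ is increasing on $(0,1)$, and let $\epsilon$ be a slowly varying function on $(g(1),\infty)$. If $$\int_{g(1)}^\infty\frac{d\tau}{\tau\,\epsilon(\tau)}=\infty,$$ then there exists $y\in L_1$ such that $$\|C_t(A)y\|_{L_1}=O\left(\frac{1}{g(1/t)\,\epsilon(g(1/t))}\right),\qquad t\to\infty,$$ but $y\notin\mathrm{dom}(g(A))$.
   Context: A Stieltjes function with representation $(0,0,\mu)$ is a function $g(z)=\int_{(0,\infty)}\frac{\mu(ds)}{z+s}$, $z>0$, where $\mu$ is a positive Radon measure on $(0,\infty)$ with $\int_{(0,\infty)}\frac{\mu(ds)}{1+s}<\infty$. Here $g(0+)=\lim_{s\to0+}g(s)$. A measurable function $\epsilon:(a,\infty)\to(0,\infty)$, $a\ge0$, is slowly varying (at infinity) if $\lim_{t\to+\infty}\epsilon(\lambda t)/\epsilon(t)=1$ for all $\lambda>0$. The operator $-A$ generates the contraction $C_0$-semigroup $(T(t)u)(s)=e^{-t/s}u(s)$ on $L_1$, and $C_t(A)u:=\frac1t\int_0^tT(\tau)u\,d\tau$, i.e. $(C_t(A)u)(s)=\frac{s(1-e^{-t/s})}{t}u(s)$, for $t>0$. The operator $g(A)$ (defined by the extended Hille–Phillips functional calculus) is the multiplication operator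 $(g(A)u)(s)=g(1/s)u(s)$ with domain $\mathrm{dom}(g(A))=\{u\in L_1:\int_1^\infty g(1/s)|u(s)|\,ds<\infty\}$.
   Formalization: The divergence condition is required of the integral of 1/(τ ε(τ)) over (b,∞) for every b ≥ g(1), i.e. at infinity; with divergence only from a singularity at a finite point, e.g. g(z)=z^{-1/2}, ε(τ)=min(τ-1,1)(1+log τ)^2, the printed claim fails. *)

(* Defs.v *)
From HB Require Import structures.
From mathcomp Require Import all_boot all_order all_algebra.
From mathcomp Require Import all_classical all_reals all_analysis.
From mathcomp Require Import ring.

Set Implicit Arguments.
Unset Strict Implicit.
Unset Printing Implicit Defensive.
Import Order.TTheory GRing.Theory Num.Theory.
Import numFieldNormedType.Exports.

Local Open Scope classical_set_scope.
Local Open Scope ring_scope.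

(* Allows [f =O_ +oo h]. *)
Canonical pinfty_filter_on (R : numFieldType) :=
  FilterType (pinfty_nbhs R) (@filter_filter R _ proper_pinfty_nbhs).

(* [mu] is a Borel measure on the whole line, of which only the restriction to
   (0, +oo) is ever used. *)
Definition radon_pos {R : realType}
    (mu : {measure set (measurableTypeR R) -> \bar R}) : Prop :=
  forall K : set R, compact K -> K `<=` `]0, +oo[ -> (mu K < +oo)%E.

Definition stieltjes_00 {R : realType} (g : R -> R)
    (mu : {measure set (measurableTypeR R) -> \bar R}) : Prop :=
  [/\ radon_pos mu,
      (\int[mu]_(s in `]0%R, +oo[) ((1 + s)^-1)%:E < +oo)%E &
      forall z : R, 0 < z ->
        (g z)%:E = (\int[mu]_(s in `]0%R, +oo[) ((z + s)^-1)%:E)%E].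

(* The values of [eps] outside (a, +oo) are irrelevant: for l > 0, l * t > a
   for all large t. *)
Definition slowly_varying {R : realType} (a : R) (eps : R -> R) : Prop :=
  [/\ 0 <= a,
      measurable_fun (`]a, +oo[ : set R) eps,
      (forall t, a < t -> 0 < eps t) &
      forall l, 0 < l -> eps (l * t) / eps t @[t --> +oo] --> (1 : R)].

Section L1_and_operators.
Context {R : realType}.
Local Notation leb := (@lebesgue_measure R).
Implicit Types (u g : R -> R) (s t : R).

(* Elements of L_1(1, +oo) are handled through representatives R -> R, of which
   only the values on (1, +oo) matter. *)
Definition L1 : set (R -> R) :=
  [set u : R -> R | leb.-integrable `]1, +oo[ (EFin \o u)].

Definition L1norm u : R := \int[leb]_(s in `]1, +oo[) `|u s|.

Definition opA u : R -> R := fun s => u s / s.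

Definition semigroupA t u : R -> R := fun s => expR (- (t / s)) * u s.

(* The L_1-valued integral over [0, t] is computed pointwise in s; cf. [cesaroAE]
   for the resulting closed form. *)
Definition cesaroA t u : R -> R :=
  fun s => t^-1 * \int[leb]_(tau in `[0, t]) semigroupA tau u s.

Definition gA g u : R -> R := fun s => g s^-1 * u s.

Definition dom_gA g : set (R -> R) :=
  [set u : R -> R | L1 u /\ (\int[leb]_(s in `]1%R, +oo[) (g s^-1 * `|u s|)%:E < +oo)%E].

Lemma is_derive_semigroupA t u s :
  is_derive t 1 (fun x => semigroupA x u s) (- opA (semigroupA t u) s).
Proof.
rewrite /opA /semigroupA.
have h : is_derive t 1 (fun x : R => - (x / s)) (- s^-1).
  have -> : (fun x : R => - (x / s)) = (- s^-1) *: (id : R -> R).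
    by apply/funext => x; change (- (x / s) = - s^-1 * x); ring.
  by apply: is_derive_eq; rewrite /GRing.scale/= mulr1.
have he : is_derive (- (t / s)) 1 (@expR R) (expR (- (t / s))).
  exact: is_derive_expR.
have hc : is_derive t 1 (@expR R \o (fun x : R => - (x / s))) _ :=
  is_derive1_comp (g := fun x : R => - (x / s)) he h.
have -> : (fun x : R => expR (- (x / s)) * u s) =
          u s *: (@expR R \o (fun x : R => - (x / s))).
  by apply/funext => x; exact: mulrC.
apply: is_derive_eq; rewrite /GRing.scale/=; ring.
Qed.

Lemma cesaroAE t u s : 0 < t -> 0 < s ->
  cesaroA t u s = s * (1 - expR (- (t / s))) / t * u s.
Proof.
move=> t0 s0; rewrite /cesaroA /Rintegral.
pose F := fun x : R => - s * semigroupA x u s.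
have dF (x : R) : is_derive x 1 F (semigroupA x u s).
  have d := is_derive_semigroupA x u s.
  have -> : F = (- s) *: (fun x => semigroupA x u s) by [].
  apply: is_derive_eq; rewrite /GRing.scale/= /opA; field.
  by rewrite gt_eqF.
have cF : continuous F.
  by move=> x; apply/differentiable_continuous/derivable1_diffP/ex_derive.
have cf : continuous (fun x : R => semigroupA x u s).
  move=> x; apply/differentiable_continuous/derivable1_diffP.
  by have d := is_derive_semigroupA x u s; apply: ex_derive.
rewrite (@continuous_FTC2 _ _ F 0 t) //.
- rewrite -EFinB/= /F /semigroupA mul0r oppr0 expR0; field.
  by rewrite gt_eqF.
- exact: continuous_subspaceT.
- split.
  + by move=> x _; apply: ex_derive.
  + exact/cvg_at_right_filter/cF.
  + exact/cvg_at_left_filter/cF.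
- by move=> x _; rewrite derive1E; apply: derive_val.
Qed.

End L1_and_operators.

(* Main.v *)
Require Import Defs.
From HB Require Import structures.
From mathcomp Require Import all_boot all_order all_algebra.
From mathcomp Require Import all_classical all_reals all_analysis.
From mathcomp Require Import measurable_realfun.
From mathcomp Require Import ring lra.
Import Order.TTheory GRing.Theory Num.Theory.
Import numFieldNormedType.Exports.

Local Open Scope classical_set_scope.
Local Open Scope ring_scope.

(* Put G(s) = g(1/s), which increases continuously to infinity, choose levels
   s_n with G(s_n) = x_n := c 2^n, and let y be the sum of the functions
   a_n 1_[s_n, s_n + 1] with a_n = 1 / (x_n eps(x_n)).  Then G(s) y(s)
   integrates to at least the sum of the 1 / eps(x_n), which diverges together
   with the integral of 1 / (tau eps(tau)).  The multiplier of C_t(A) is at most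
   min(1, s/t), so ||C_t(A) y|| is at most the sum of the
   a_n min(1, (s_n + 1)/t).  The monotonicity of tau^alpha g(tau) gives
   s_(n+1) >= 2^(1/alpha) s_n, so that a_n decreases and a_n s_n increases
   geometrically: for s_N <= t <= s_(N+1) that sum is O(a_N), which is
   O(1 / (G(t) eps(G(t)))).  Comparing eps on [x_n, 2 x_n] with eps(x_n) uses
   that slow variation is locally uniform. *)

(** * Slow variation: comparison up to constants, uniform over dilations in [[1, 2]] *)

Lemma lebesgue_measure_scale {R : realType} (u : R) (A : set R) : 0 < u ->
  measurable A ->
  lebesgue_measure A = (u%:E * lebesgue_measure ( *%R u @^-1` A))%E.
Proof.
move=> u0 mA.
have mf : measurable_fun setT
    (fun v : measurableTypeR R => u * v : measurableTypeR R).
  exact: mulrl_measurable.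
pose m := mscale (NngNum (ltW u0)) (pushforward (@lebesgue_measure R)
  (fun v : measurableTypeR R => u * v : measurableTypeR R)).
rewrite (@lebesgue_measure_unique R (m mf))//.
move=> X [[a b]] _ <-.
transitivity (u%:E * lebesgue_measure ( *%R u @^-1` `]a, b]))%E; last by [].
have -> : *%R u @^-1` `]a, b] = `](a / u), (b / u)]%classic.
  apply/seteqP; split => x /=; rewrite !in_itv/= ltr_pdivrMr// ler_pdivlMr//;
  by rewrite [x * u]mulrC.
rewrite !lebesgue_measure_itv/= !lte_fin ltr_pM2r ?invr_gt0//.
case: ifP => _; last by rewrite mule0.
by rewrite -!EFinD -EFinM -mulrBl mulrC divfK// gt_eqF.
Qed.

Section uniform_convergence.
Context {R : realType} (a : R) (eps : R -> R).
Hypothesis sv : slowly_varying a eps.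

Let a0 : 0 <= a. Proof. by case: sv. Qed.

(** Asking for the bounds on the whole tail [n <= m] makes these sets increase with [n], so that
    continuity from below applies to them. *)
Definition comparable_dilations (x : nat -> R) (n : nat) : set R :=
  [set v | 1 <= v <= 5 /\ forall m, (n <= m)%N ->
    eps (x m) / 2 <= eps (v * x m) <= 2 * eps (x m)].

Lemma comparable_dilations_measurable (x : nat -> R) n : (forall m, a < x m) ->
  measurable (comparable_dilations x n).
Proof.
move=> ax.
have -> : comparable_dilations x n =
    \bigcap_(m in [set m | (n <= m)%N]) (`[1, 5] `&`
      (fun v => eps (v * x m)) @^-1` `[eps (x m) / 2, 2 * eps (x m)]).
  apply/seteqP; split => v.
    by move=> [v15 h] m /= nm; rewrite !in_itv/= v15 h.
  move=> h; split; first by have [] := h n (leqnn n); rewrite /= in_itv.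
  by move=> m nm; have [_] := h m nm; rewrite /= in_itv.
apply: bigcap_measurable; first by exists n => /=.
move=> m _.
have mf : measurable_fun (`[1, 5] : set R) (fun v => eps (v * x m)).
  have [_ me _ _] := sv.
  apply: (measurable_comp (F := (`]a, +oo[ : set R))) => //.
  - move=> _ [v /= + <-]; rewrite !in_itv/= andbT => /andP[v1 _].
    by apply: lt_le_trans (ax m) _; rewrite ler_peMl// (le_trans a0)// ltW.
  - exact: measurable_funM.
exact: mf.
Qed.

(** Pointwise slow variation puts each [v] of [[1, 5]] in some set of this increasing family, so the
    measures tend to 4; [7 / 2] is a value below 4 large enough for the overlap argument. *)
Lemma comparable_dilations_measure (x : nat -> R) : (forall m, a < x m) ->
  x n @[n --> \oo] --> +oo ->
  \forall n \near \oo,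
    ((7 / 2)%:E < lebesgue_measure (comparable_dilations x n))%E.
Proof.
move=> ax xoo.
have bE : \bigcup_n comparable_dilations x n = `[1, 5]%classic.
  apply/seteqP; split => v /=; first by move=> [n _ []]; rewrite in_itv.
  rewrite in_itv/= => v15.
  have v0 : 0 < v by case/andP: v15 => v1 _; rewrite (lt_le_trans _ v1).
  have [_ _ ep el] := sv.
  have := cvg_comp _ _ xoo (el v v0).
  move=> /cvgrPdist_le /(_ (1/2)) h.
  have : \forall n \near \oo, `|1 - eps (v * x n) / eps (x n)| <= 1/2.
    by apply: h; lra.
  move=> [n _ hn]; exists n => //; split=> // m nm.
  have := hn m nm; rewrite /= ler_distlC => /andP[h1 h2].
  have e0 := ep _ (ax m).
  move: h1 h2; rewrite ler_pdivlMr// ler_pdivrMr// => h1 h2.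
  by apply/andP; split; lra.
have c : lebesgue_measure (comparable_dilations x n) @[n --> \oo] -->
    lebesgue_measure (`[1, 5] : set R).
  rewrite -bE; apply: nondecreasing_cvg_mu.
  - by move=> n; exact: comparable_dilations_measurable.
  - by rewrite bE; exact: measurable_itv.
  - move=> n m nm; apply/subsetPset => v [v15 h]; split=> // k mk.
    by apply: h; exact: leq_trans mk.
apply: (c [set z | ((7 / 2)%:E < z)%E]).
apply: open_ereal_gt'; rewrite lebesgue_measure_itv/= lte_fin ifT; last by lra.
by rewrite -EFinD lte_fin; lra.
Qed.

(* Steinhaus argument: if the bound failed along x_n and u_n x_n, the sets of
   good dilations of x_n and of u_n x_n, seen on a common scale, would both be
   almost full in an interval, hence would meet. *)
Lemma slowly_varying_bounded : \forall x \near +oo, forall u : R,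
  1 <= u <= 2 -> eps x <= 4 * eps (u * x) /\ eps (u * x) <= 4 * eps x.
Proof.
apply: contrapT => H.
(* Failure of the claim gives counterexamples [(x, u)] with [x] arbitrarily large, hence a sequence
   of them tending to infinity. *)
have /choice[f Hf] : forall n : nat, exists p : R * R, [/\ a < p.1, n%:R <= p.1,
    1 <= p.2 <= 2 & ~ (eps p.1 <= 4 * eps (p.2 * p.1) /\
      eps (p.2 * p.1) <= 4 * eps p.1)].
  move=> n; apply: contrapT => Hn; apply: H.
  exists (Num.max a n%:R); split; first exact: num_real.
  move=> x; rewrite gt_max => /andP[ax nx] u u12; apply: contrapT => Hu.
  by apply: Hn; exists (x, u); split=> //; exact: ltW.
pose x n := (f n).1; pose u n := (f n).2.
have ax n : a < x n by case: (Hf n).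
have u12 n : 1 <= u n <= 2 by case: (Hf n).
have x0 n : 0 < x n by exact: le_lt_trans (ax n).
have xux n : x n <= u n * x n.
  by case/andP: (u12 n) => u1 _; rewrite ler_peMl// ltW.
have xoo : x n @[n --> \oo] --> +oo.
  apply: (ger_cvgy _ (@cvgr_idn R)).
  by apply: nearW => n; case: (Hf n).
have uxoo : u n * x n @[n --> \oo] --> +oo.
  by apply: (ger_cvgy _ xoo); exact: nearW.
have aux n : a < u n * x n by exact: lt_le_trans (xux n).
near \oo => n.
have hA : ((7 / 2)%:E < lebesgue_measure (comparable_dilations x n))%E.
  by near: n; exact: comparable_dilations_measure.
have hB : ((7 / 2)%:E <
    lebesgue_measure (comparable_dilations (fun n => u n * x n)%R n))%E.
  by near: n; exact: comparable_dilations_measure.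
have mA := comparable_dilations_measurable x n ax.
have mB := comparable_dilations_measurable (fun n => u n * x n) n aux.
set A := comparable_dilations x n in hA mA.
set B := comparable_dilations _ n in hB mB.
have /andP[u1 u2] := u12 n.
have u0 : 0 < u n by lra.
(* [W] is [B] dilated by [u n]: since [v / u n * (u n * x n) = v * x n], both [A] and [W] now
   constrain [eps (v * x n)]. *)
pose W := *%R (u n)^-1 @^-1` B.
have mW : measurable W.
  rewrite -[W]setTI; have := @mulrl_measurable R setT (u n)^-1.
  by apply => //.
have hW : (lebesgue_measure W = (u n)%:E * lebesgue_measure B)%E.
  rewrite (lebesgue_measure_scale (u n))//; congr (_ * lebesgue_measure _)%E.
  by apply/seteqP; split => v; rewrite /W/= mulKf ?gt_eqF.
(* If [A] and [W] were disjoint, their measures would give [7/2 * (1 + u n) <= 5 * u n - 1], which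
   forces [3 <= u n]. *)
have [AW|/set0P[v [[_ Av] [_ Wv]]]] := eqVneq (A `&` W) set0.
  have AW5 : A `|` W `<=` `[1, 5 * u n].
    move=> v /= [[/andP[v1 v5] _]|[/andP[v1 v5] _]]; rewrite in_itv/=.
      by rewrite v1/=; nra.
    move: v1 v5; rewrite [_^-1 * _]mulrC ler_pdivlMr// ler_pdivrMr// mul1r => v1 v5.
    by rewrite v5 andbT; lra.
  pose J : set R := `[1, 5 * u n]%classic.
  have leJ : (lebesgue_measure (A `|` W) <= lebesgue_measure J)%E.
    apply: le_measure => //; rewrite inE; first exact: measurableU.
    exact: measurable_itv.
  have hU : lebesgue_measure (A `|` W) =
      (lebesgue_measure A + lebesgue_measure W)%E by apply: measureU.
  move: leJ; rewrite hU hW lebesgue_measure_itv/= lte_fin ifT; last by lra.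
  have : (((7 / 2)%:E + (u n)%:E * (7/2)%:E) <=
      lebesgue_measure A + (u n)%:E * lebesgue_measure B)%E.
    by apply: leeD; [exact: ltW|rewrite lee_pmul2l ?ltW].
  move=> /le_trans h /h; rewrite -EFinM -!EFinD lee_fin; lra.
(* At a common [v], [eps (v * x n)] is within a factor 2 of both [eps (x n)] and [eps (u n * x n)],
   whence the factor 4. *)
have := Av n (leqnn n); have := Wv n (leqnn n).
rewrite mulrA [_^-1 * _ * _]mulrAC mulVf ?gt_eqF// mul1r.
move=> /andP[w1 w2] /andP[w3 w4].
have [_ _ _ []] := Hf n.
rewrite -/(x n) -/(u n); split; lra.
Unshelve. all: by end_near.
Qed.

End uniform_convergence.

(** * Monotonicity and continuity of Stieltjes functions *)

Section stieltjes.
Context {R : realType} (g : R -> R)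
  (mu : {measure set (measurableTypeR R) -> \bar R}).
Hypothesis gmu : stieltjes_00 g mu.

Let kernelE (z : R) : 0 < z ->
  (g z)%:E = (\int[mu]_(s in `]0%R, +oo[) ((z + s)^-1)%:E)%E.
Proof. by case: gmu => _ _; apply. Qed.

Let kernel_ge0 (z s : R) : 0 < z -> `]0, +oo[%classic s -> (0 <= ((z + s)^-1)%:E)%E.
Proof. by move=> z0; rewrite /= in_itv/= andbT lee_fin invr_ge0 => s0; lra. Qed.

Let kernel_measurable (z : R) : 0 < z ->
  measurable_fun (`]0, +oo[ : set (measurableTypeR R))
    (fun s : R => ((z + s)^-1)%:E).
Proof.
move=> z0; apply/measurable_EFinP.
apply: open_continuous_measurable_fun; first exact: interval_open.
move=> s; rewrite inE/= in_itv/= andbT => s0.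
apply: cvgV; first by rewrite gt_eqF// addr_gt0.
by apply: cvgD; [exact: cvg_cst|exact: cvg_id].
Qed.

Lemma stieltjes_ge0 (z : R) : 0 < z -> 0 <= g z.
Proof.
move=> z0; rewrite -lee_fin kernelE//; apply: integral_ge0 => s s0.
exact: kernel_ge0.
Qed.

Lemma stieltjes_nonincreasing (z w : R) : 0 < z -> z <= w -> g w <= g z.
Proof.
move=> z0 zw; have w0 : 0 < w by lra.
rewrite -lee_fin !kernelE//; apply: ge0_le_integral => //.
- by move=> s; exact: kernel_ge0.
- exact: kernel_measurable.
- exact: kernel_measurable.
- move=> s /=; rewrite in_itv/= andbT => s0.
  by rewrite lee_fin lef_pV2 ?posrE; lra.
Qed.

(** The kernel [z / (z + s)] increases with [z]. Together with the monotonicity of [g] this bounds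
    the variation of [g] from both sides. *)
Lemma stieltjes_mul_nondecreasing (z w : R) : 0 < z -> z <= w -> z * g z <= w * g w.
Proof.
move=> z0 zw; have w0 : 0 < w by lra.
have E (x : R) : 0 < x -> (x * g x)%:E =
    (\int[mu]_(s in `]0%R, +oo[) (x%:E * ((x + s)^-1)%:E))%E.
  move=> x0; rewrite EFinM kernelE// ge0_integralZl//.
  - exact: kernel_measurable.
  - by move=> s; exact: kernel_ge0.
  - by rewrite lee_fin ltW.
rewrite -lee_fin !E//; apply: ge0_le_integral => //.
- move=> s s0; rewrite mule_ge0 ?lee_fin ?(ltW z0)//.
  by have := kernel_ge0 _ _ z0 s0; rewrite lee_fin.
- by apply: measurable_funeM; exact: kernel_measurable.
- by apply: measurable_funeM; exact: kernel_measurable.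
- move=> s /=; rewrite in_itv/= andbT => s0.
  rewrite -!EFinM lee_fin ler_pdivrMr ?addr_gt0// mulrAC ler_pdivlMr ?addr_gt0//.
  by nra.
Qed.

Lemma stieltjes_continuous (z : R) : 0 < z -> {for z, continuous g}.
Proof.
move=> z0; apply/cvgrPdist_le => e e0.
have gz0 := stieltjes_ge0 _ z0.
(* The two monotonicity properties give the Lipschitz constant [2 * g z / z] for [y > z / 2]; adding
   1 keeps [k] positive even if [g z = 0]. *)
pose k := 2 * g z / z + 1.
have k0 : 0 < k by rewrite /k ltr_wpDl// divr_ge0 ?mulr_ge0// ltW.
near=> y.
have y0 : z / 2 < y by near: y; apply: lt_nbhsr; lra.
have yz : `|z - y| <= e / k.
  by near: y; apply: cvgr_dist_le; [exact: cvg_id|rewrite divr_gt0].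
have : `|g z - g y| <= 2 * g z / z * `|z - y|.
  have [zy|/ltW yz'] := leP z y.
    have h1 := stieltjes_nonincreasing _ _ z0 zy.
    have h2 := stieltjes_mul_nondecreasing _ _ z0 zy.
    rewrite ger0_norm ?subr_ge0// distrC ger0_norm ?subr_ge0//.
    rewrite mulrAC ler_pdivlMr//; nra.
  have yp : 0 < y by lra.
  have h1 := stieltjes_nonincreasing _ _ yp yz'.
  have h2 := stieltjes_mul_nondecreasing _ _ yp yz'.
  rewrite distrC ger0_norm ?subr_ge0// ger0_norm ?subr_ge0//.
  rewrite mulrAC ler_pdivlMr//; nra.
move/le_trans; apply; apply: (@le_trans _ _ (k * `|z - y|)).
  by rewrite ler_wpM2r//; rewrite /k; lra.
by rewrite -ler_pdivlMl// mulrC.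
Unshelve. all: by end_near.
Qed.

(** Intermediate values on [[z, 1]], where [z] is so small that [v <= g z]. *)
Lemma stieltjes_level (v : R) : g z @[z --> 0^'+] --> +oo -> g 1 <= v ->
  exists2 s, 1 <= s & g s^-1 = v.
Proof.
move=> goo g1v.
have [z [z0 z1 vgz]] : exists z, [/\ 0 < z, z <= 1 & v <= g z].
  have : \forall z \near 0^'+, [/\ 0 < z, z <= 1 & v <= g z].
    near=> z; split.
    - by near: z; exact: nbhs_right_gt.
    - by near: z; exact: nbhs_right_le.
    - by near: z; move/cvgryPge : goo; apply.
  by move=> /filter_ex.
have [//||c] := @IVT R g z 1 v z1.
- apply: continuous_in_subspaceT => x; rewrite inE/= in_itv/= => /andP[zx _].
  by apply: stieltjes_continuous; lra.
- by rewrite ge_min le_max vgz g1v orbT.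
- rewrite in_itv/= => /andP[zc c1] gc; exists c^-1; last by rewrite invrK.
  by rewrite invf_ge1//; lra.
Unshelve. all: by end_near.
Qed.

End stieltjes.

(** * Sums of a sequence [a] that decays geometrically while [a * s] grows geometrically *)

Section geometric_sums.
Context {R : realType} (a s : nat -> R) (theta : R).
Hypotheses (a0 : forall n, 0 < a n) (s1 : forall n, 1 <= s n).
Hypotheses (a34 : forall n, a n.+1 <= 3 / 4 * a n).
Hypotheses (theta01 : 0 < theta < 1)
  (as_theta : forall n, a n * s n <= theta * (a n.+1 * s n.+1)).

Lemma geometric_head N :
  \sum_(0 <= n < N.+1) a n * s n <= a N * s N / (1 - theta).
Proof.
have /andP[t0 t1] := theta01.
have d0 : 0 < 1 - theta by lra.
have as0 n : 0 < a n * s n by rewrite mulr_gt0// (lt_le_trans _ (s1 n)).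
elim: N => [|N IH].
  by rewrite big_nat1 ler_pdivlMr//; have := as0 0%N; nra.
rewrite big_nat_recr//=.
have h : a N * s N / (1 - theta) <= theta * (a N.+1 * s N.+1) / (1 - theta).
  by rewrite ler_pM2r ?invr_gt0.
have -> : a N.+1 * s N.+1 / (1 - theta) =
    theta * (a N.+1 * s N.+1) / (1 - theta) + a N.+1 * s N.+1.
  by field; rewrite gt_eqF.
by rewrite lerD2r (le_trans IH).
Qed.

Lemma geometric_tail N M : \sum_(N <= n < N + M) a n <= 4 * a N.
Proof.
(* Strengthened for the induction: the reserve [4 * a (N + M)] pays for the next term, since
   [a + 4 * (3 / 4 * a) = 4 * a]. *)
have : \sum_(N <= n < N + M) a n + 4 * a (N + M)%N <= 4 * a N.
  elim: M => [|M IH]; first by rewrite addn0 big_geq// add0r.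
  rewrite addnS big_nat_recr ?leq_addr//=.
  by have := a34 (N + M)%N; lra.
by have := a0 (N + M)%N; lra.
Qed.

(** Split after index [N]: up to [N] the minimum is at most [2 * s n / t], a head sum controlled by
    [s N / t <= 1]; beyond [N] it is at most 1, a tail sum. *)
Lemma geometric_total N M t : s N <= t ->
  \sum_(0 <= n < M) a n * Num.min 1 ((s n + 1) / t) <=
    (2 / (1 - theta) + 4) * a N.
Proof.
have /andP[t0 t1] := theta01.
move=> sNt; have tp : 0 < t by rewrite (lt_le_trans _ sNt)// (lt_le_trans _ (s1 N)).
pose b n := a n * Num.min 1 ((s n + 1) / t).
have s0 n : 0 < s n by rewrite (lt_le_trans _ (s1 n)).
have b0 n : 0 <= b n.
  by rewrite mulr_ge0 ?(ltW (a0 n))// le_min ler01 divr_ge0 ?(ltW tp)// addr_ge0// ltW.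
apply: (@le_trans _ _ (\sum_(0 <= n < N.+1 + M) b n)).
  rewrite (@big_cat_nat _ _ _ M 0 (N.+1 + M))//= ?leq_addl// lerDl.
  by apply: sumr_ge0.
rewrite (@big_cat_nat _ _ _ N.+1 0 (N.+1 + M))//= ?leq_addr// mulrDl lerD//.
  apply: (@le_trans _ _ (2 / t * (\sum_(0 <= n < N.+1) a n * s n))).
    rewrite mulr_sumr; apply: ler_sum => n _.
    have -> : 2 / t * (a n * s n) = a n * (2 * s n / t) by ring.
    rewrite ler_pM2l// ge_min; apply/orP; right.
    by rewrite ler_pM2r ?invr_gt0//; have := s1 n; lra.
  apply: (@le_trans _ _ (2 / t * (a N * s N / (1 - theta)))).
    by rewrite ler_pM2l ?divr_gt0// geometric_head.
  have -> : 2 / t * (a N * s N / (1 - theta)) = 2 / (1 - theta) * a N * (s N / t) by ring.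
  rewrite ler_piMr//; last by rewrite ler_pdivrMr// mul1r.
  by rewrite mulr_ge0 ?(ltW (a0 N))// divr_ge0//; lra.
apply: (@le_trans _ _ (\sum_(N.+1 <= n < N.+1 + M) a n)).
  by apply: ler_sum => n _; rewrite /b ler_piMr ?(ltW (a0 n))// ge_min lexx.
by apply: (le_trans (geometric_tail _ _)); have := a34 N; have := a0 N; lra.
Qed.

End geometric_sums.

(** * Series of weighted indicators and dyadic sampling of an integral *)

Lemma nneseries_le {R : realType} (u : nat -> R) (b : R) :
  (forall n, 0 <= u n) -> (forall M, \sum_(0 <= n < M) u n <= b) ->
  (\sum_(0 <= n <oo) (u n)%:E <= b%:E)%E.
Proof.
move=> u0 ub; apply: lime_le.
  by apply: is_cvg_nneseries => n _ _; rewrite lee_fin.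
by apply: nearW => M; rewrite sumEFin lee_fin.
Qed.

(** Monotone convergence. It serves both the dyadic majorant of [1 / (tau * eps tau)] and the vector
    [y]. *)
Lemma integral_indic_series {R : realType} (D : set R) (I : nat -> set R)
    (a : nat -> R) (w : R -> R) :
  measurable D -> (forall n, measurable (I n)) -> (forall n, I n `<=` D) ->
  (forall n, 0 <= a n) -> (forall x, D x -> 0 <= w x) -> measurable_fun D w ->
  (\int[lebesgue_measure]_(x in D)
      ((w x)%:E * \sum_(0 <= n <oo) (a n * \1_(I n) x)%:E) =
   \sum_(0 <= n <oo) ((a n)%:E * \int[lebesgue_measure]_(x in I n) (w x)%:E))%E.
Proof.
move=> mD mI ID a0 w0 mw.
under eq_integral => x xD.
  rewrite -nneseriesZl; last by move=> n _; rewrite lee_fin mulr_ge0.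
  over.
have wI0 n x : D x -> (0 <= (w x)%:E * (\1_(I n) x)%:E)%E.
  by move=> Dx; rewrite mule_ge0 ?lee_fin ?w0.
have mwI n : measurable_fun D (fun x => (w x)%:E * (\1_(I n) x)%:E)%E.
  apply: emeasurable_funM; first exact/measurable_EFinP.
  by apply/measurable_EFinP/measurable_indic.
have E n x : ((w x)%:E * (a n * \1_(I n) x)%:E =
    (a n)%:E * ((w x)%:E * (\1_(I n) x)%:E))%E.
  by rewrite -!EFinM mulrCA.
rewrite integral_nneseries//.
- apply: eq_eseriesr => n _.
  under eq_integral do rewrite E.
  rewrite ge0_integralZl//;
    [|exact: mwI|by move=> x; exact: wI0|by rewrite lee_fin].
  congr (_ * _)%E; rewrite -{2}(setIidr (ID n)) integral_mkcondr.
  by rewrite epatch_indic.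
- move=> n.
  have -> : (fun x => (w x)%:E * (a n * \1_(I n) x)%:E)%E =
      (fun x => (a n)%:E * ((w x)%:E * (\1_(I n) x)%:E))%E by apply/funext => x.
  by apply: measurable_funeM; exact: mwI.
- by move=> n x Dx; rewrite E mule_ge0 ?lee_fin//; exact: wI0.
Qed.

Lemma measurable_fun_inv_gt0 {R : realType} (D : set R) (f : R -> R) :
  measurable D -> (forall x, D x -> 0 < f x) -> measurable_fun D f ->
  measurable_fun D (fun x => (f x)^-1).
Proof.
move=> mD f0 mf.
apply: (measurable_comp (F := (`]0, +oo[ : set R)) (f := fun x : R => x^-1)) => //.
  by move=> _ [x Dx <-] /=; rewrite in_itv/= andbT f0.
apply: open_continuous_measurable_fun; first exact: interval_open.
move=> x; rewrite inE/= in_itv/= andbT => x0.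
by apply: cvgV; [rewrite gt_eqF|exact: cvg_id].
Qed.

(** On the dyadic interval from [x n] to [2 * x n] the integrand is at most [4 / (x n * eps (x n))],
    and the interval has length [x n], so it contributes at most [4 / eps (x n)]. *)
Lemma sampled_series_divergent {R : realType} (eps : R -> R) (c : R) : 0 < c ->
  measurable_fun (`]c, +oo[ : set R) eps -> (forall x, c <= x -> 0 < eps x) ->
  (forall x u, c <= x -> 1 <= u <= 2 -> eps x <= 4 * eps (u * x)) ->
  (\int[lebesgue_measure]_(tau in `]c, +oo[) ((tau * eps tau)^-1)%:E = +oo)%E ->
  (\sum_(0 <= n <oo) ((eps (c * 2 ^+ n))^-1)%:E = +oo)%E.
Proof.
move=> c0 me e0 eu int_oo.
pose x n := c * 2 ^+ n.
have xS n : x n.+1 = 2 * x n by rewrite /x exprS; ring.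
have p0 n : 1 <= 2 ^+ n :> R by rewrite exprn_ege1// ler1n.
have cx n : c <= x n by rewrite /x ler_peMr// ltW.
have x0 n : 0 < x n by exact: lt_le_trans (cx n).
pose I n : set R := `](x n), (x n.+1)]%classic.
pose D : set R := `]c, +oo[%classic.
have mI n : measurable (I n) by exact: measurable_itv.
have mD : measurable D by exact: measurable_itv.
have ID n : I n `<=` D.
  move=> t; rewrite /I /D/= !in_itv/= andbT => /andP[xt _].
  exact: le_lt_trans (cx n) xt.
have D0 t : D t -> 0 < t * eps t.
  by rewrite /D/= in_itv/= andbT => ct; rewrite mulr_gt0 ?e0 ?(ltW ct)// (lt_trans c0).
pose b n := 4 / (x n * eps (x n)).
have b0 n : 0 <= b n by rewrite divr_ge0// mulr_ge0// ltW// e0.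
have h : (\int[lebesgue_measure]_(tau in D) ((tau * eps tau)^-1)%:E <=
    \int[lebesgue_measure]_(t in D)
      ((cst 1 t)%:E * \sum_(0 <= n <oo) (b n * \1_(I n) t)%:E))%E.
  apply: ge0_le_integral.
  - exact: measurable_itv.
  - by move=> t Dt; rewrite lee_fin invr_ge0 ltW// D0.
  - apply/measurable_EFinP; apply: measurable_fun_inv_gt0 => //.
    by apply: measurable_funM.
  - apply: emeasurable_funM; first exact/measurable_EFinP.
    apply: ge0_emeasurable_sum.
      by move=> n t _ _; rewrite lee_fin mulr_ge0.
    move=> n _; apply/measurable_EFinP; apply: measurable_funM => //.
    by apply: measurable_indic; exact: mI.
  - move=> t Dt; rewrite /cst mul1e.
    have ct : c < t by move: Dt; rewrite /D/= in_itv/= andbT.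
    have exn : exists n, t <= x n.+1.
      exists (Num.bound (t / c)); rewrite /x -ler_pdivrMl// mulrC.
      apply: (le_trans (ltW (archi_boundP _))).
        by rewrite divr_ge0// ltW// (lt_trans c0).
      by rewrite -natrX ler_nat ltnW// (ltn_trans (ltnSn _))// ltn_expl.
    (* The least such [n] locates [t] in [I n]; for [n = 0] the lower bound is [x 0 = c < t]. *)
    have [n xnt minn] := ex_minnP exn.
    have xlt : x n < t.
      case: n minn {xnt} => [|n] minn; first by rewrite /x expr0 mulr1.
      by rewrite ltNge; apply/negP => /minn; rewrite ltnn.
    apply: (@le_trans _ _ (\sum_(0 <= i < n.+1) (b i * \1_(I i) t)%:E)%E); last first.
      by apply: nneseries_lim_ge => i _ _; rewrite lee_fin mulr_ge0.
    rewrite sumEFin lee_fin big_nat_recr//=.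
    apply: (@le_trans _ _ (b n)); last first.
      rewrite indicE mem_set ?mulr1; last by rewrite /I/= in_itv/= xlt.
      by rewrite lerDr; apply: sumr_ge0 => i _; rewrite mulr_ge0.
    have h := eu (x n) (t / x n) (cx n).
    have {h} : eps (x n) <= 4 * eps t.
      rewrite -(divfK (lt0r_neq0 (x0 n)) t); apply: h.
      by rewrite ler_pdivlMr// ler_pdivrMr// mul1r -xS xnt ltW.
    have e1 := e0 _ (cx n); have e2 := e0 _ (ltW ct); have xn := x0 n.
    move=> h; rewrite /b ler_pdivlMr ?mulr_gt0// ler_pdivrMl ?D0//.
    by nra.
have : (\int[lebesgue_measure]_(t in D)
    ((cst 1 t)%:E * \sum_(0 <= n <oo) (b n * \1_(I n) t)%:E) =
    4%:E * \sum_(0 <= n <oo) ((eps (x n))^-1)%:E)%E.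
  rewrite integral_indic_series//.
  rewrite -nneseriesZl; last by move=> n _; rewrite lee_fin invr_ge0 ltW// e0.
  apply: eq_eseriesr => n _.
  have -> : (\int[lebesgue_measure]_(t in I n) (cst 1 t)%:E = (x n)%:E)%E.
    transitivity (\int[lebesgue_measure]_(t in I n) cst 1%E t)%E; first by [].
    rewrite integral_cst; last exact: mI.
    rewrite /I/= lebesgue_measure_itv/= lte_fin.
    rewrite ifT; last by rewrite xS; have := x0 n; lra.
    by rewrite mul1e -EFinD xS; congr EFin; ring.
  rewrite -!EFinM; congr EFin; rewrite /b.
  by field; rewrite !gt_eqF ?e0.
rewrite int_oo in h.
move=> E; move: h; rewrite E leye_eq => /eqP.
set S := (\sum_(0 <= n <oo) _)%E => hS.
(* Nonnegativity excludes [-oo], and [4 * S = +oo] excludes a finite value. *)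
have : (0 <= S)%E by apply: nneseries_ge0 => n _ _; rewrite lee_fin invr_ge0 ltW// e0.
by move: hS; case: S.
Qed.

(** * The sum of bumps on unit intervals and the norm of its Cesàro means *)

Lemma integral_unit_itv_le {R : realType} (s b : R) (w : R -> R) :
  measurable_fun (`[s, s + 1] : set R) w ->
  (forall x, s <= x <= s + 1 -> 0 <= w x <= b) ->
  (\int[lebesgue_measure]_(x in `[s, (s + 1)%R]) (w x)%:E <= b%:E)%E.
Proof.
move=> mw wb.
apply: (@le_trans _ _ (\int[lebesgue_measure]_(x in `[s, (s + 1)%R]) (cst b%:E x))%E).
  apply: ge0_le_integral => //.
  - by move=> x /=; rewrite in_itv/= => /wb/andP[]; rewrite lee_fin.
  - exact/measurable_EFinP.
  - by move=> x /=; rewrite in_itv/= => /wb/andP[]; rewrite lee_fin.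
rewrite integral_cst//= lebesgue_measure_itv/= lte_fin ltrDl ltr01.
by rewrite -EFinD addrAC subrr add0r mule1.
Qed.

Lemma integral_unit_itv_ge {R : realType} (s b : R) (w : R -> R) : 0 <= b ->
  measurable_fun (`[s, s + 1] : set R) w ->
  (forall x, s <= x <= s + 1 -> b <= w x) ->
  (b%:E <= \int[lebesgue_measure]_(x in `[s, (s + 1)%R]) (w x)%:E)%E.
Proof.
move=> b0 mw wb.
apply: (@le_trans _ _ (\int[lebesgue_measure]_(x in `[s, (s + 1)%R]) (cst b%:E x))%E).
  rewrite integral_cst//= lebesgue_measure_itv/= lte_fin ltrDl ltr01.
  by rewrite -EFinD addrAC subrr add0r mule1.
by apply: ge0_le_integral => //; exact/measurable_EFinP.
Qed.

(** The integral formula is kept for a general weight [w] because it is applied with three: the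
    constant 1 for integrability, the multiplier of [cesaroA], and [g] at the inverse. *)
Lemma bump_series {R : realType} (a s : nat -> R) (B : R) :
  (forall n, 0 <= a n) -> (forall n, 1 < s n) ->
  (forall M, \sum_(0 <= n < M) a n <= B) ->
  exists y : R -> R, [/\ forall x, 0 <= y x, L1 y &
    forall w : R -> R, measurable_fun (`]1, +oo[ : set R) w ->
      (forall x, 1 < x -> 0 <= w x) ->
      (\int[lebesgue_measure]_(x in `]1%R, +oo[) (w x * y x)%:E =
       \sum_(0 <= n <oo) ((a n)%:E *
         \int[lebesgue_measure]_(x in `[s n, (s n + 1)%R]) (w x)%:E))%E].
Proof.
move=> a0 s1 aB.
pose D : set R := `]1, +oo[%classic.
pose I n : set R := `[s n, s n + 1]%classic.
have ID n : I n `<=` D.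
  move=> t; rewrite /I /D/= !in_itv/= andbT => /andP[st _].
  exact: lt_le_trans (s1 n) st.
have mI n : measurable (I n) by exact: measurable_itv.
have mD : measurable D by exact: measurable_itv.
pose f x := (\sum_(0 <= n <oo) (a n * \1_(I n) x)%:E)%E.
have f0 x : (0 <= f x)%E.
  by apply: nneseries_ge0 => n _ _; rewrite lee_fin mulr_ge0.
(* The bumps may overlap, but each indicator is at most 1, so [B] bounds the sum pointwise and
   taking [fine] loses nothing. *)
have fB x : (f x <= B%:E)%E.
  apply: nneseries_le; first by move=> n; rewrite mulr_ge0.
  move=> M; apply: le_trans (aB M); apply: ler_sum => n _.
  by rewrite ler_piMr// indicE lern1 leq_b1.
have ffin x : f x \is a fin_num.
  by rewrite ge0_fin_numE// (le_lt_trans (fB x))// ltry.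
have fy x : (fine (f x))%:E = f x by rewrite fineK.
have formula (w : R -> R) : measurable_fun D w ->
    (forall x, 1 < x -> 0 <= w x) ->
    (\int[lebesgue_measure]_(x in D) (w x * fine (f x))%:E =
       \sum_(0 <= n <oo) ((a n)%:E * \int[lebesgue_measure]_(x in I n) (w x)%:E))%E.
  move=> mw w0.
  rewrite -(integral_indic_series D I a w mD mI ID a0) //; last first.
    by move=> x; rewrite /D/= in_itv/= andbT; exact: w0.
  by apply: eq_integral => x _; rewrite EFinM fy.
exists (fun x => fine (f x)); split => //; first by move=> x; rewrite fine_ge0.
apply/integrableP; split.
  have -> : EFin \o (fun x => fine (f x)) = f by apply/funext => x /=; rewrite fy.
  apply: ge0_emeasurable_sum.
    by move=> n t _ _; rewrite lee_fin mulr_ge0.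
  move=> n _; apply/measurable_EFinP; apply: measurable_funM => //.
  by apply: measurable_indic; exact: mI.
have -> : (\int[lebesgue_measure]_(x in D) `|(EFin \o (fun x => fine (f x))) x| =
    \int[lebesgue_measure]_(x in D) (cst 1 x * fine (f x))%:E)%E.
  apply: eq_integral => x _ /=; rewrite mul1r ger0_norm//.
  by rewrite fine_ge0.
rewrite formula//.
apply: (@le_lt_trans _ _ (\sum_(0 <= n <oo) (a n)%:E)%E).
  apply: lee_nneseries => n _.
    by rewrite mule_ge0 ?lee_fin//; apply: integral_ge0 => x _; rewrite lee_fin.
  rewrite -[leRHS]mule1 lee_wpmul2l ?lee_fin//.
  by apply: integral_unit_itv_le => // x _; rewrite /cst ler01 lexx.
by apply: le_lt_trans (nneseries_le _ _ a0 aB) _; rewrite ltry.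
Qed.

(** With [v = t / x], the bound 1 comes from [1 - v <= expR (- v)] and the bound [x / t] from
    [0 < expR (- v)]. *)
Lemma cesaro_weight_bounds {R : realType} (t x : R) : 0 < t -> 0 < x ->
  0 <= x * (1 - expR (- (t / x))) / t <= Num.min 1 (x / t).
Proof.
move=> t0 x0.
have e1 : expR (- (t / x)) <= 1.
  by rewrite -[leRHS](@expR0 R) ler_expR oppr_le0 divr_ge0// ltW.
have e2 : 1 - t / x <= expR (- (t / x)) by apply: expR_ge1Dx.
have e3 := expR_gt0 (- (t / x)).
apply/andP; split; first by rewrite divr_ge0 ?(ltW t0)// mulr_ge0 ?(ltW x0)//; lra.
rewrite le_min; apply/andP; split.
  rewrite ler_pdivrMr// mul1r -[leRHS](divfK (lt0r_neq0 x0)) mulrC ler_pM2r//; lra.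
by rewrite ler_pM2r ?invr_gt0// ler_piMr ?(ltW x0)//; lra.
Qed.

Lemma measurable_cesaro_weight {R : realType} (t : R) :
  measurable_fun (`]1, +oo[ : set R) (fun x => x * (1 - expR (- (t / x))) / t).
Proof.
apply: open_continuous_measurable_fun; first exact: interval_open.
move=> x; rewrite inE/= in_itv/= andbT => x1.
apply: cvgM; last exact: cvg_cst.
apply: cvgM; first exact: cvg_id.
apply: cvgB; first exact: cvg_cst.
apply: (cvg_comp (fun y : R => - (t / y)) expR); last exact: continuous_expR.
apply: cvgN; apply: cvgM; first exact: cvg_cst.
by apply: cvgV; [rewrite gt_eqF// (lt_trans ltr01)|exact: cvg_id].
Qed.

(** On the [n]-th bump the multiplier is at most [min 1 ((s n + 1) / t)], so a bound on these
    partial sums passes to the norm. The lower bound 0 serves to remove the absolute value in the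
    big-O estimate. *)
Lemma L1norm_cesaro_bumps {R : realType} (a s : nat -> R) (y : R -> R)
    (t b : R) :
  (forall n, 0 <= a n) -> (forall n, 1 < s n) -> (forall x, 0 <= y x) ->
  (forall w : R -> R,
    measurable_fun (`]1, +oo[ : set R) w -> (forall x, 1 < x -> 0 <= w x) ->
    (\int[lebesgue_measure]_(x in `]1%R, +oo[) (w x * y x)%:E =
     \sum_(0 <= n <oo) ((a n)%:E *
       \int[lebesgue_measure]_(x in `[s n, (s n + 1)%R]) (w x)%:E))%E) ->
  0 < t -> (forall M, \sum_(0 <= n < M) a n * Num.min 1 ((s n + 1) / t) <= b) ->
  0 <= L1norm (cesaroA t y) <= b.
Proof.
move=> a0 s1 y0 yE t0 ub.
rewrite /L1norm /Rintegral.
pose w x := x * (1 - expR (- (t / x))) / t.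
have w0 x : 1 < x -> 0 <= w x.
  by move=> x1; case/andP: (cesaro_weight_bounds _ _ t0 (lt_trans ltr01 x1)).
have -> : (\int[lebesgue_measure]_(x in `]1%R, +oo[) `|cesaroA t y x|%:E =
    \int[lebesgue_measure]_(x in `]1%R, +oo[) (w x * y x)%:E)%E.
  apply: eq_integral => x; rewrite inE/= in_itv/= andbT => x1.
  rewrite cesaroAE// ?(lt_trans ltr01)// ger0_norm//.
  by rewrite mulr_ge0// w0.
rewrite yE//; last exact: measurable_cesaro_weight.
have term0 n : (0 <= (a n)%:E *
    \int[lebesgue_measure]_(x in `[s n, (s n + 1)%R]) (w x)%:E)%E.
  rewrite mule_ge0 ?lee_fin//; apply: integral_ge0 => x /=.
  by rewrite in_itv/= lee_fin => /andP[sx _]; rewrite w0// (lt_le_trans (s1 n)).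
set S := (\sum_(0 <= n <oo) _)%E.
have S0 : (0 <= S)%E by apply: nneseries_ge0.
have Sb : (S <= b%:E)%E.
  apply: le_trans (nneseries_le (fun n => a n * Num.min 1 ((s n + 1) / t)) b _ ub).
    apply: lee_nneseries => // n _.
    rewrite EFinM lee_wpmul2l ?lee_fin//; apply: integral_unit_itv_le.
      apply: measurable_funS (measurable_cesaro_weight t) => //.
      move=> x /=; rewrite !in_itv/= andbT => /andP[sx _].
      exact: lt_le_trans (s1 n) sx.
    move=> x /andP[sx xs]; have x0 : 0 < x.
      by rewrite (lt_trans ltr01)// (lt_le_trans (s1 n)).
    have /andP[-> h] := cesaro_weight_bounds _ _ t0 x0.
    apply: (le_trans h).
    by rewrite le_min !ge_min lexx/= ler_pM2r ?invr_gt0// xs orbT.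
  move=> n; rewrite mulr_ge0// le_min ler01 divr_ge0 ?(ltW t0)//.
  by have := s1 n; lra.
have Sfin : S \is a fin_num by rewrite ge0_fin_numE// (le_lt_trans Sb)// ltry.
by rewrite fine_ge0//= -lee_fin fineK.
Qed.

(** * Growth of the levels and construction of [y] *)

(** Comparing [tau^alpha * g tau] at [1 / s'] and [1 / s] gives [2 * s^alpha <= s'^alpha]; then take
    the root of order [alpha]. *)
Lemma level_ratio {R : realType} (g : R -> R) (alpha s s' : R) :
  0 < alpha ->
  {in `]0, 1[ &, {homo (fun tau => tau `^ alpha * g tau) : x y / x <= y}} ->
  1 < s -> s <= s' -> 0 < g s^-1 -> g s'^-1 = 2 * g s^-1 ->
  2 `^ alpha^-1 * s <= s'.
Proof.
move=> al0 gi s1 ss' gs0 g2.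
have s0 : 0 < s by lra.
have s'0 : 0 < s' by lra.
have inv01 (x : R) : 1 < x -> x^-1 \in `]0, 1[.
  by move=> x1; rewrite in_itv/= invr_gt0 invf_lt1 ?x1 ?andbT; lra.
have := gi s'^-1 s^-1 (inv01 _ (lt_le_trans s1 ss')) (inv01 _ s1).
rewrite lef_pV2 ?posrE// => /(_ ss').
rewrite g2 mulrA ler_pM2r// => h.
have sa := powR_gt0 alpha s0; have s'a := powR_gt0 alpha s'0.
have powRV (u : R) : 0 < u -> u^-1 `^ alpha = (u `^ alpha)^-1.
  by move=> u0; rewrite -powR_inv1 ?ltW// -powRrM mulN1r powRN.
have {}h : 2 * s `^ alpha <= s' `^ alpha.
  by move: h; rewrite !powRV// ler_pdivrMl// ler_pdivlMr.
have : (2 * s `^ alpha) `^ alpha^-1 <= (s' `^ alpha) `^ alpha^-1.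
  apply: ge0_ler_powR => //; rewrite ?nnegrE ?invr_ge0 ?mulr_ge0 ?powR_ge0 ?(ltW al0)//.
by rewrite powRM ?powR_ge0// -!powRrM mulfV ?gt_eqF// !powRr1// ltW.
Qed.

(** Requiring [eps_div] for every lower limit [b] expresses that the integral diverges at infinity,
    rather than through a singularity at [g 1]. *)
Theorem corollary4p7 (R : realType) (g eps : R -> R) (alpha : R)
    (mu : {measure set (measurableTypeR R) -> \bar R})
    (g_stieltjes : stieltjes_00 g mu)
    (g0y : g z @[z --> 0^'+] --> +oo)
    (alpha01 : 0 < alpha < 1)
    (g_incr : {in `]0, 1[ &, {homo (fun tau => tau `^ alpha * g tau) :
                 x y / x <= y}})
    (eps_sv : slowly_varying (g 1) eps)
    (eps_div : forall b : R, g 1 <= b ->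
      (\int[lebesgue_measure]_(tau in `]b, +oo[) ((tau * eps tau)^-1)%:E
         = +oo)%E) :
  exists y : R -> R,
    [/\ L1 y,
        (fun t => L1norm (cesaroA t y)) =O_ +oo
          (fun t => (g t^-1 * eps (g t^-1))^-1) &
        ~ dom_gA g y].
Proof.
have /andP[al0 al1] := alpha01.
pose p : R := 2 `^ alpha^-1.
have p2 : 2 < p.
  have ia1 : 1 < alpha^-1 by rewrite invf_gt1.
  rewrite /p /powR pnatr_eq0/= -[ltLHS](@lnK R) ?posrE// ltr_expR.
  by rewrite ltr_pMl// ln_gt0// ltr1n.
(* The midpoint of 1 and [p / 2]: it exceeds 1, the limit of [eps (2 * x) / eps x], and still
   satisfies [2 * rho < p]. *)
pose rho := (1 + p / 2) / 2.
have rho1 : 1 < rho by rewrite /rho; lra.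
have [g1_ge0 me e0 el] := eps_sv.
(* The factor 4 is too coarse for geometric decay, so sharper bounds at dilation 2 are taken from
   the limit itself: [2 / 3] yields the ratio [3 / 4] for [a], and [rho] the growth of [a * s]. *)
have [c [g1c cb cr]] : exists c, [/\ g 1 < c,
    forall x u, c <= x -> 1 <= u <= 2 ->
      eps x <= 4 * eps (u * x) /\ eps (u * x) <= 4 * eps x &
    forall x, c <= x -> 2 / 3 * eps x <= eps (2 * x) <= rho * eps x].
  have h : \forall x \near +oo, 2 / 3 * eps x <= eps (2 * x) <= rho * eps x.
    near=> x.
    have ex0 : 0 < eps x.
      by apply: e0; near: x; apply: nbhs_pinfty_gt; exact: num_real.
    have r1 : 2 / 3 <= eps (2 * x) / eps x.
      by near: x; apply: (cvgr_ge _ (el 2 (ltr0n _ 2))); lra.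
    have r2 : eps (2 * x) / eps x <= rho.
      by near: x; apply: (cvgr_le _ (el 2 (ltr0n _ 2))); lra.
    by rewrite -ler_pdivlMr// r1 -ler_pdivrMr.
  have [M1 [_ h1]] := slowly_varying_bounded _ _ eps_sv.
  have [M2 [_ h2]] := h.
  (* The added 1 clears the strict thresholds and gives [g 1 < c], which later forces [1 < s n]. *)
  exists (1 + Num.max (g 1) (Num.max M1 M2)).
  have l1 : g 1 <= Num.max (g 1) (Num.max M1 M2) by rewrite le_max lexx.
  have l2 : M1 <= Num.max (g 1) (Num.max M1 M2) by rewrite !le_max lexx orbT.
  have l3 : M2 <= Num.max (g 1) (Num.max M1 M2) by rewrite !le_max lexx !orbT.
  split; first lra.
    by move=> x u cx; apply: h1; lra.
  by move=> x cx; apply: h2; lra.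
have c0 : 0 < c by lra.
pose x n := c * 2 ^+ n.
have xS n : x n.+1 = 2 * x n by rewrite /x exprS; ring.
have cx n : c <= x n by rewrite /x ler_peMr ?(ltW c0)// exprn_ege1// ler1n.
have x0 n : 0 < x n by exact: lt_le_trans (cx n).
have ex0 n : 0 < eps (x n) by apply: e0; exact: lt_le_trans (cx n).
have /choice[s Hs] n : exists sn, 1 < sn /\ g sn^-1 = x n.
  have [sn sn1 gsn] := stieltjes_level _ _ g_stieltjes (x n) g0y
    (ltW (lt_le_trans g1c (cx n))).
  exists sn; split=> //; rewrite lt_neqAle sn1 andbT; apply/eqP => sn_eq.
  by move: gsn; rewrite -sn_eq invr1 => g1x; have := cx n; rewrite -g1x; lra.
have s1 n : 1 < s n by case: (Hs n).
have gs n : g (s n)^-1 = x n by case: (Hs n).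
have s0 n : 0 < s n by have := s1 n; lra.
have g_decr u v : 0 < u -> u <= v -> g u^-1 <= g v^-1.
  move=> u0 uv; have v0 : 0 < v by lra.
  apply: (stieltjes_nonincreasing _ _ g_stieltjes); first by rewrite invr_gt0.
  by rewrite lef_pV2 ?posrE.
have ps n : p * s n <= s n.+1.
  apply: (level_ratio g) => //; rewrite ?gs//.
  rewrite leNgt; apply/negP => /ltW ss; have := g_decr _ _ (s0 _) ss.
  by rewrite !gs xS; have := x0 n; lra.
pose a n := (x n * eps (x n))^-1.
have a0 n : 0 < a n by rewrite invr_gt0 mulr_gt0.
have a34 n : a n.+1 <= 3 / 4 * a n.
  have /andP[h _] := cr _ (cx n).
  have e1 := ex0 n; have e2 := ex0 n.+1; have x1 := x0 n.
  rewrite /a ler_pdivlMr ?mulr_gt0// ler_pdivrMl ?mulr_gt0//.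
  by move: e2; rewrite xS => e2; nra.
(* One step multiplies [s] by at least [p] and divides [a] by at most [2 * rho]. *)
pose theta := 2 * rho / p.
have theta01 : 0 < theta < 1.
  by rewrite /theta ltr_pdivrMr ?divr_gt0//= /rho; lra.
have as_theta n : a n * s n <= theta * (a n.+1 * s n.+1).
  have /andP[_ h] := cr _ (cx n).
  have e1 := ex0 n; have e2 := ex0 n.+1; have x1 := x0 n.
  have h1 : a n <= rho * 2 * a n.+1.
    rewrite /a ler_pdivlMr ?mulr_gt0// ler_pdivrMl ?mulr_gt0//.
    by rewrite xS; nra.
  have h2 : 2 * rho * s n <= theta * s n.+1.
    have <- : theta * p = 2 * rho by rewrite /theta divfK// gt_eqF//; lra.
    by rewrite -mulrA ler_pM2l//; case/andP: theta01.
  have := a0 n.+1; have := s0 n; nra.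
have s_ge1 n : 1 <= s n by exact: ltW.
have a_ge0 n : 0 <= a n by exact: ltW.
have aB M : \sum_(0 <= n < M) a n <= 4 * a 0%N.
  by have := geometric_tail a a0 a34 0 M; rewrite add0n.
have [y [y0 yL1 yE]] := bump_series a s _ a_ge0 s1 aB.
exists y; split=> //.
  (* The factor 8 is [2 * 4], from [g t^-1 <= 2 * x N] and [eps (g t^-1) <= 4 * eps (x N)]. *)
  apply/eqO_exP; exists ((2 / (1 - theta) + 4) * 8).
    by rewrite mulr_gt0// addr_gt0// divr_gt0//; lra.
  near=> t.
  have s0t : s 0%N <= t by near: t; apply: nbhs_pinfty_ge; exact: num_real.
  have t0 : 0 < t by have := s0 0%N; lra.
  (* Such an index exists because [p > 2] makes [s n >= n]; the least one works, the case 0 being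
     covered by [s 0 <= t]. *)
  have [N sNt tsN] : exists2 N, s N <= t & t <= s N.+1.
    have exn : exists n, t <= s n.+1.
      have sn n : n%:R <= s n.
        elim: n => [|n IH]; first exact: ltW.
        by have := ps n; have := s1 n; rewrite -natr1; nra.
      exists (Num.bound t); apply: le_trans (sn _).
      apply: (le_trans (ltW (archi_boundP (ltW t0)))).
      by rewrite ler_nat.
    have [n tsn minn] := ex_minnP exn; exists n => //.
    case: n minn {tsn} => [|n] minn //.
    by apply/ltW; rewrite ltNge; apply/negP => /minn; rewrite ltnn.
  have /andP[L0 Lb] := L1norm_cesaro_bumps a s y t _ a_ge0 s1 y0 yE t0
    (fun M => geometric_total a s theta a0 s_ge1 a34 theta01 as_theta N M t sNt).
  have xG : x N <= g t^-1 by rewrite -gs; exact: g_decr.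
  have Gx : g t^-1 <= 2 * x N by rewrite -xS -gs; exact: g_decr.
  have eG : eps (g t^-1) <= 4 * eps (x N).
    have [|_] := cb (x N) (g t^-1 / x N) (cx N); last by rewrite divfK// gt_eqF.
    by rewrite ler_pdivlMr// ler_pdivrMr// mul1r xG Gx.
  have eG0 : 0 < eps (g t^-1).
    by apply: e0; apply: lt_le_trans xG; exact: lt_le_trans (cx N).
  have G0 : 0 < g t^-1 by exact: lt_le_trans xG.
  rewrite ger0_norm// ger0_norm; last by rewrite invr_ge0 mulr_ge0// ltW.
  apply: (le_trans Lb); rewrite -mulrA ler_wpM2l//.
    by rewrite addr_ge0// divr_ge0//; lra.
  rewrite /a ler_pdivlMr ?mulr_gt0// ler_pdivrMl ?mulr_gt0//.
  have := ex0 N; have := x0 N; nra.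
(* Membership in the domain is refuted by showing that the integral of [g s^-1 * y s] is [+oo]. *)
move=> [_]; apply/negP; rewrite -leNgt leye_eq; apply/eqP.
have mg : measurable_fun (`]1, +oo[ : set R) (fun u => g u^-1).
  apply: open_continuous_measurable_fun; first exact: interval_open.
  move=> u; rewrite inE/= in_itv/= andbT => u1.
  have u0 : 0 < u by lra.
  apply: (cvg_comp (fun v : R => v^-1) g).
    by apply: cvgV; [rewrite gt_eqF|exact: cvg_id].
  by apply: (stieltjes_continuous _ _ g_stieltjes); rewrite invr_gt0.
have g_ge0 u : 1 < u -> 0 <= g u^-1.
  by move=> u1; apply: (stieltjes_ge0 _ _ g_stieltjes); rewrite invr_gt0; lra.
under eq_integral do rewrite (ger0_norm (y0 _)).
rewrite yE//; apply/eqP; rewrite -leye_eq.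
(* Here [+oo] is replaced by the divergent series of [1 / eps (x n)] and compared termwise: on the
   [n]-th bump [g u^-1 >= x n], and [a n * x n = 1 / eps (x n)]. *)
rewrite -(sampled_series_divergent eps c c0) //.
- apply: lee_nneseries => n _.
    by move=> _; rewrite lee_fin invr_ge0; apply: ltW; exact: ex0.
  apply: (@le_trans _ _ ((a n)%:E * (x n)%:E)%E).
    by rewrite -EFinM lee_fin /a invfM mulrAC mulVf ?mul1r// gt_eqF.
  rewrite lee_wpmul2l ?lee_fin//; apply: integral_unit_itv_ge.
  + exact: ltW.
  + apply: measurable_funS mg => // u /=; rewrite !in_itv/= andbT => /andP[su _].
    exact: lt_le_trans (s1 n) su.
  + by move=> u /andP[su _]; rewrite -gs; exact: g_decr.
- apply: measurable_funS me => // u /=; rewrite !in_itv/= !andbT; exact: lt_trans.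
- by move=> u cu; apply: e0; exact: lt_le_trans cu.
- by move=> u v cu uv; case: (cb u v cu uv).
- by apply: eps_div; exact: ltW.
Unshelve. all: by end_near.
Qed.
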